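(* Let $\mathcal T=[t_{i_1,\ldots,i_d}]\in\mathbb R^{n^{\times d}}_{ps,+}$. Then $$\log\rho(\mathcal T)=\max_{\mu\in\Omega(n^{\times(d-1)})}\ \sum_{i_1,\dots,i_d\in[n]}\mu_{i_1,\dots,i_d}\log\left(\frac{\big(\sum_{k_2,\dots,k_d\in[n]}\mu_{i_1,k_2,\dots,k_d}\big)\,t_{i_1,\dots,i_d}}{\mu_{i_1,\dots,i_d}}\right).$$ Assume in addition that $\mathcal T$ is weakly irreducible. Let $u>0$ be the positive eigenvector of $\mathcal T$ (unique up to scaling), so $\mathcal T(u)=\rho(\mathcal T)u^{\circ(d-1)}$, and let $w>0$ be the vector associated with $u$ by $A^\top w=(d-1)\rho(\mathcal T)w$, $w^\top u=1$, where $A=\operatorname{diag}(u)^{-(d-2)}D\mathcal T(u)$. Define $\mu=[\mu_{i_1,\ldots,i_d}]\in\mathbb R^{n^{\times d}}_{ps,+}$ by $$\mu_{i_1,\ldots,i_d}=\frac{1}{\rho(\mathcal T)}\,w_{i_1}u_{i_1}^{-(d-2)}\,t_{i_1,\ldots,i_d}\,u_{i_2}\cdots u_{i_d},\qquad i_1,\ldots,i_d\in[n].$$ Then $\mu$ is an occupation measure whose support is $\operatorname{supp}\mathcal T$, and $$\log\rho(\mathcal T)=\sum_{i_1,\ldots,i_d\in[n]}\mu_{i_1,\dots,i_d}\log\left(\frac{\big(\sum_{k_2,\dots,k_d\in[n]}\mu_{i_1,k_2,\dots,k_d}\big)\,t_{i_1,\dots,i_d}}{\mu_{i_1,\dots,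i_d}}\right).$$
   Context: Let $n\ge1$, $d\ge3$ be integers, $[n]=\{1,\dots,n\}$. $\mathbb R^{n^{\times d}}_{ps,+}$ is the set of tensors $\mathcal T=[t_{i_1,\dots,i_d}]$, $i_1,\dots,i_d\in[n]$, with nonnegative real entries that are symmetric in the last $d-1$ indices $i_2,\dots,i_d$. For $x\in\mathbb C^n$, $\mathcal T(x)\in\mathbb C^n$ has entries $\mathcal T(x)_i=\sum_{i_2,\dots,i_d\in[n]}t_{i,i_2,\dots,i_d}x_{i_2}\cdots x_{i_d}$, and $x^{\circ p}=(x_1^p,\dots,x_n^p)^\top$. An eigenvalue of $\mathcal T$ is $\lambda\in\mathbb C$ with $\mathcal T(x)=\lambda x^{\circ(d-1)}$ for some nonzero $x\in\mathbb C^n$; the spectral radius $\rho(\mathcal T)$ is the maximum modulus of the eigenvalues. $\operatorname{supp}\mathcal T=\{(i_1,\dots,i_d): t_{i_1,\dots,i_d}>0\}$. $\mathcal T$ is weakly irreducible if the digraph on $[n]$ with an edge $(i,j)$ whenever $t_{i,j_1,\dots,j_{d-1}}>0$ for some $j_1,\dots,j_{d-1}$ with $j\in\{j_1,\dots,j_{d-1}\}$ is strongly connected (when $n=1$, the zero tensor is not regarded as weakly irreducible). In that case there is a vector $u>0$ (all entries positive), unique up to positive scaling, with $\mathcal T(u)=\rho(\mathcal T)u^{\circ(d-1)}$. The matrix $D\mathcal T(u)\in\mathbb R^{n\times n}$ has entries $D\mathcal T(u)_{ij}=(d-1)\sum_{i_3,\dots,i_d}t_{i,j,i_3,\dots,i_d}u_{i_3}\cdots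 u_{i_d}$. With $A:=\operatorname{diag}(u)^{-(d-2)}D\mathcal T(u)$, which is an irreducible nonnegative matrix with $Au=(d-1)\rho(\mathcal T)u$, there is a unique $w>0$ with $A^\top w=(d-1)\rho(\mathcal T)w$ and $w^\top u=1$. A tensor $\mu\in\mathbb R^{n^{\times d}}_{ps,+}$ is an occupation measure if $\sum_{i_1,\dots,i_d\in[n]}\mu_{i_1,\dots,i_d}=1$ and, for all $j\in[n]$, $\sum_{i_2,\dots,i_d\in[n]}\mu_{j,i_2,\dots,i_d}=\sum_{i_1,i_3,\dots,i_d\in[n]}\mu_{i_1,j,i_3,\dots,i_d}$. $\Omega(n^{\times(d-1)})$ is the set of occupation measures. Conventions: $\log0=-\infty$; a term with $\mu_{i_1,\dots,i_d}=0$ equals $0$; a term with $\mu_{i_1,\dots,i_d}>0$ and $t_{i_1,\dots,i_d}=0$ equals $-\infty$ (so the maximum may equal $-\infty$). *)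

(* Defs.v *)
From HB Require Import structures.
From mathcomp Require Import all_boot all_order all_algebra.
From mathcomp Require Import all_classical all_reals all_analysis.
From mathcomp Require Import complex.

Set Implicit Arguments.
Unset Strict Implicit.
Unset Printing Implicit Defensive.

Import Order.TTheory GRing.Theory Num.Theory.

Local Open Scope classical_set_scope.
Local Open Scope ring_scope.
Local Open Scope complex_scope.

(* A d-way n-dimensional tensor, d > 0, with zero-based indices: the entry
   t_{i_1,i_2,...,i_d} is t i J, where i = i_1 and J = (i_2, ..., i_d). *)
Definition tensor (K : Type) (n d : nat) := 'I_n -> d.-1.-tuple 'I_n -> K.

Definition partially_symmetric (K : Type) (n d : nat) (t : tensor K n d) :=
  forall (i : 'I_n) (J J' : d.-1.-tuple 'I_n), perm_eq J J' -> t i J = t i J'.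

Definition nonneg_tensor (R : realType) (n d : nat) (t : tensor R n d) :=
  forall (i : 'I_n) (J : d.-1.-tuple 'I_n), 0 <= t i J.

Definition ps_nonneg (R : realType) (n d : nat) : set (tensor R n d) :=
  [set t | partially_symmetric t /\ nonneg_tensor t].

Definition supp (R : realType) (n d : nat) (t : tensor R n d) :
    set ('I_n * d.-1.-tuple 'I_n) :=
  [set p | 0 < t p.1 p.2].

Definition tensor_app (K : comNzRingType) (n d : nat) (t : tensor K n d)
    (x : 'cV[K]_n) : 'cV[K]_n :=
  \col_i \sum_(J : d.-1.-tuple 'I_n) t i J * \prod_(j <- J) x j 0.

Definition hadamard_pow (K : comNzRingType) (n : nat) (x : 'cV[K]_n) (p : nat)
    : 'cV[K]_n :=
  \col_i x i 0 ^+ p.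

Definition tensor_complex (R : realType) (n d : nat) (t : tensor R n d) :
    tensor R[i] n d :=
  fun i J => (t i J)%:C.

Definition eigenvalue_tensor (R : realType) (n d : nat) (t : tensor R n d)
    (lambda : R[i]) : Prop :=
  exists2 x : 'cV[R[i]]_n, x != 0 &
    tensor_app (tensor_complex t) x = lambda *: hadamard_pow x d.-1.

Definition is_maximum (disp : Order.disp_t) (X : porderType disp)
    (S : set X) (m : X) : Prop :=
  S m /\ ubound S m.

(* The norm on R[i] takes its values in R[i], hence the cast of r. *)
Definition eigenvalue_moduli (R : realType) (n d : nat) (t : tensor R n d) :
    set R :=
  [set r | exists2 lambda : R[i], eigenvalue_tensor t lambda
                                & `|lambda| = r%:C].

(* The default value 0 is used only if there is no maximum. *)
Definition spectral_radius (R : realType) (n d : nat) (t : tensor R n d) : R :=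
  xget 0 [set r | is_maximum (eigenvalue_moduli t) r].

Definition tensor_edge (R : realType) (n d : nat) (t : tensor R n d) :
    rel 'I_n :=
  fun i j => [exists J : d.-1.-tuple 'I_n, (0 < t i J) && (j \in J)].

(* [connect] is reflexive, so a single vertex is always strongly connected;
   the second clause excludes the zero tensor in dimension one. *)
Definition weakly_irreducible (R : realType) (n d : nat) (t : tensor R n d)
    : Prop :=
  (forall i j : 'I_n, connect (tensor_edge t) i j) /\
  (n = 1%N -> exists (i : 'I_n) (J : d.-1.-tuple 'I_n), t i J != 0).

Definition positive_vec (R : realType) (n : nat) (x : 'cV[R]_n) : Prop :=
  forall i : 'I_n, 0 < x i 0.

(* J ranges over the tuples (j, i_3, ..., i_d). *)
Definition tensor_jacobian (R : realType) (n d : nat) (t : tensor R n d)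
    (u : 'cV[R]_n) : 'M[R]_n :=
  \matrix_(i, j) (d.-1%:R *
    \sum_(J : d.-1.-tuple 'I_n | ohead J == Some j)
      t i J * \prod_(k <- behead J) u k 0).

Definition scaled_jacobian (R : realType) (n d : nat) (t : tensor R n d)
    (u : 'cV[R]_n) : 'M[R]_n :=
  diag_mx (\row_i (u i 0) ^- d.-2) *m tensor_jacobian t u.

Definition marginal1 (R : realType) (n d : nat) (mu : tensor R n d) (j : 'I_n)
    : R :=
  \sum_(J : d.-1.-tuple 'I_n) mu j J.

Definition marginal2 (R : realType) (n d : nat) (mu : tensor R n d) (j : 'I_n)
    : R :=
  \sum_(i : 'I_n) \sum_(J : d.-1.-tuple 'I_n | ohead J == Some j) mu i J.

Definition occupation_measures (R : realType) (n d : nat) :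
    set (tensor R n d) :=
  [set mu | [/\ ps_nonneg mu,
                \sum_(i : 'I_n) \sum_(J : d.-1.-tuple 'I_n) mu i J = 1
              & forall j : 'I_n, marginal1 mu j = marginal2 mu j]].

(* [lne] is the extended logarithm, with lne 0 = -oo. *)
Definition entropy_term (R : realType) (n d : nat) (t mu : tensor R n d)
    (i : 'I_n) (J : d.-1.-tuple 'I_n) : \bar R :=
  if mu i J == 0 then 0%E
  else ((mu i J)%:E * lne ((marginal1 mu i * t i J / mu i J)%:E))%E.

Definition entropy (R : realType) (n d : nat) (t mu : tensor R n d) : \bar R :=
  (\sum_(i : 'I_n) \sum_(J : d.-1.-tuple 'I_n) entropy_term t mu i J)%E.

Definition eigen_measure (R : realType) (n d : nat) (t : tensor R n d)
    (u w : 'cV[R]_n) : tensor R n d :=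
  fun i J => (spectral_radius t)^-1 * w i 0 * (u i 0) ^- d.-2 * t i J *
             \prod_(j <- J) u j 0.

(* Main.v *)
(* For a monotone, positively homogeneous form f of degree m = d - 1, adding
   e (sum x)^m makes f strictly monotone, and Wielandt's argument (maximize r
   subject to r x^m <= f x on the simplex) gives a positive eigenvector.
   Letting e -> 0, compactness yields v >= 0 with f v = rho v^m, while the
   perturbed eigenvectors show that for every e > 0 some u > 0 satisfies
   f u <= (rho + e) u^m.  Comparing |x| with such a u bounds every complex
   eigenvalue by rho, so rho is the spectral radius.

   Upper bound: with such a u, partial symmetry and equality of marginals give
   sum mu_iJ (m log u_i - log u_J) = 0, so u can be inserted in the logarithm;
   then log y <= y - 1.  Attainment: for rho > 0 the numbers
   t_iJ v_J / (rho v_i^m) are transition probabilities on the support of v; a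
   stationary distribution p of the induced chain i -> J_1 gives the maximizer
   mu_iJ = p_i t_iJ v_J / (rho v_i^m).  In the weakly irreducible case
   p_i = w_i u_i. *)
Require Import Defs.
From mathcomp Require Import all_boot all_order all_algebra all_fingroup.
From mathcomp Require Import all_classical all_reals all_analysis.
From mathcomp Require Import complex ring lra.

Import Order.TTheory GRing.Theory Num.Theory.
Import numFieldNormedType.Exports.

Local Open Scope classical_set_scope.
Local Open Scope ring_scope.

Set Implicit Arguments.
Unset Strict Implicit.
Unset Printing Implicit Defensive.

(** * Continuity and compactness on the standard simplex *)

Lemma continuous_sum (R : realType) (T : topologicalType) (I : Type)
    (r : seq I) (P : pred I) (F : I -> T -> R) :
  (forall i, continuous (F i)) ->
  continuous (fun x => \sum_(i <- r | P i) F i x).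
Proof.
move=> cF; apply: continuous_big => //; exact: add_continuous.
Qed.

Lemma continuous_prod (R : realType) (T : topologicalType) (I : Type)
    (r : seq I) (P : pred I) (F : I -> T -> R) :
  (forall i, continuous (F i)) ->
  continuous (fun x => \prod_(i <- r | P i) F i x).
Proof.
move=> cF; apply: continuous_big => //; exact: mul_continuous.
Qed.

Lemma continuous_exp (R : realType) (T : topologicalType) (g : T -> R)
    (m : nat) :
  continuous g -> continuous (fun x => g x ^+ m).
Proof.
move=> cg; have -> : (fun x => g x ^+ m) = (fun x => \prod_(k < m) g x).
  by apply/funext => x; rewrite prodr_const card_ord.
exact: continuous_prod.
Qed.

Definition simplex (R : realType) (n : nat) : set ('I_n -> R) :=
  [set x | (forall i, 0 <= x i) /\ \sum_i x i = 1].

Lemma simplex_le1 (R : realType) (n : nat) (x : 'I_n -> R) i :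
  simplex x -> x i <= 1.
Proof.
by case=> x0 <-; rewrite (bigD1 i)//= lerDl sumr_ge0.
Qed.

Lemma simplex_neq0 (R : realType) (n : nat) (x : 'I_n -> R) :
  simplex x -> exists i, x i != 0.
Proof.
case=> x0 x1; apply/existsP; rewrite -[X in is_true X]negbK negb_exists.
apply/negP => /forallP x_eq0; move: x1; rewrite big1 => [/eqP|i _].
  by rewrite eq_sym oner_eq0.
by apply/eqP; have := x_eq0 i; rewrite negbK.
Qed.

Lemma simplex_normalize (R : realType) (n : nat) (x : 'I_n -> R) i :
  (forall k, 0 <= x k) -> x i != 0 ->
  0 < \sum_k x k /\ simplex (fun k => (\sum_k x k)^-1 * x k).
Proof.
move=> x0 xi0.
have s0 : 0 < \sum_k x k.
  by rewrite (bigD1 i)//= ltr_wpDr ?sumr_ge0// lt_neqAle eq_sym xi0 x0.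
split=> //; split=> [k|]; first by rewrite mulr_ge0// invr_ge0 ltW.
by rewrite -mulr_sumr mulVf// gt_eqF.
Qed.

(** Turns approximate solutions into exact ones. The penalty [|\sum_i x i - 1|] moves the
    minimization to the compact unit cube; a minimizer of the penalized function has value 0, so it
    lies on the simplex and is a zero of [F]. *)
Lemma simplex_zero (R : realType) (n : nat) (F : ('I_n -> R) -> R) :
  continuous (fun x : 'rV[R]_n => F (x ord0)) ->
  (forall x, 0 <= F x) ->
  (forall e, 0 < e -> exists2 x, simplex x & F x <= e) ->
  exists2 x, simplex x & F x = 0.
Proof.
move=> cF F0 Fe.
pose G (x : 'rV[R]_n) := F (x ord0) + `|\sum_i x ord0 i - 1|.
have cG : continuous G.
  have cS : continuous (fun x : 'rV[R]_n => \sum_i x ord0 i).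
    by apply: continuous_sum => i; exact: coord_continuous.
  move=> x; apply: (@cvgD R R^o _ (nbhs x) _
      (fun y : 'rV[R]_n => F (y ord0))
      (fun y : 'rV[R]_n => `|\sum_i y ord0 i - 1|)); first exact: cF.
  apply: (@cvg_norm R R^o); apply: (@cvgB R R^o _ _ _ _ (cst 1)).
    exact: cS.
  exact: cvg_cst.
pose B : set 'rV[R]_n := [set v | forall i : 'I_n, `[0, 1]%classic (v ord0 i)].
have cB : compact B.
  apply: (@rV_compact R n (fun=> `[0, 1]%classic)) => _.
  exact: segment_compact.
have rowK (x : 'I_n -> R) : (\row_i x i) ord0 = x.
  by apply/funext => i; rewrite mxE.
have simplexB x : simplex x -> B (\row_i x i).
  move=> sx i; rewrite /= mxE in_itv/= simplex_le1// andbT.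
  by case: sx.
have B0 : B !=set0.
  by have [x /simplexB Bx _] := Fe 1 ltr01; exists (\row_i x i).
have [c Bc minc] := compact_EVT_min B0 cB (continuous_subspaceT cG).
have G0 : G c <= 0.
  apply/ler_addgt0Pr => e e0; rewrite add0r.
  have [x sx Fx] := Fe e e0.
  apply: (le_trans (minc (\row_i x i) _)); first exact/mem_set/simplexB.
  by rewrite /G rowK; case: sx => _ ->; rewrite subrr normr0 addr0.
move: G0; rewrite /G => G0.
have := F0 (c ord0); have := normr_ge0 (\sum_i c ord0 i - 1) => N0 Fc0.
have F00 : F (c ord0) = 0 by lra.
have /eqP : `|\sum_i c ord0 i - 1| = 0 by lra.
rewrite normr_eq0 subr_eq0 => /eqP c1.
exists (c ord0) => //; split=> // i.
by move/set_mem : Bc => /(_ i); rewrite /= in_itv/= => /andP[].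
Qed.

(** * Perron-Frobenius theory for monotone homogeneous forms *)

(** Continuity is phrased through row vectors, whose coordinate boxes are compact. *)
Record monotone_form (R : realType) (n m : nat)
    (f : ('I_n -> R) -> 'I_n -> R) : Prop := MonotoneForm {
  form_cont : forall i, continuous (fun x : 'rV[R]_n => f (x ord0) i);
  form_ge0 : forall x i, (forall k, 0 <= x k) -> 0 <= f x i;
  form_le : forall x y i, (forall k, 0 <= x k <= y k) -> f x i <= f y i;
  form_scale : forall c x i, f (fun k => c * x k) i = c ^+ m * f x i }.

(* Compare the two vectors at an index maximizing [x i / u i]. *)
Lemma collatz_wielandt_le (R : realType) (n m : nat)
    (f : ('I_n -> R) -> 'I_n -> R) (r s : R) (x u : 'I_n -> R) :
  monotone_form m f ->
  (forall i, 0 <= x i) -> (exists i, x i != 0) ->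
  (forall i, r * x i ^+ m <= f x i) ->
  (forall i, 0 < u i) -> (forall i, f u i <= s * u i ^+ m) -> r <= s.
Proof.
move=> mf x0 [i0 xi0] rx u0 us.
pose q i := x i / u i.
have [i _ maxq] := @arg_maxP _ R _ i0 predT q isT.
have qi0 : 0 < q i.
  apply: lt_le_trans (maxq i0 isT).
  by rewrite divr_gt0// lt_neqAle eq_sym xi0 x0.
have xq k : x k = q k * u k by rewrite /q divfK// gt_eqF.
have := rx i; rewrite xq exprMn => H.
have : r * (q i ^+ m * u i ^+ m) <= s * (q i ^+ m * u i ^+ m).
  apply: (le_trans H); rewrite mulrCA.
  apply: (@le_trans _ _ (q i ^+ m * f u i)).
    rewrite -(form_scale mf); apply: (form_le mf) => k.
    by rewrite x0 xq ler_pM2r//; exact: maxq.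
  by rewrite ler_pM2l ?exprn_gt0.
by rewrite ler_pM2r// mulr_gt0// exprn_gt0.
Qed.

Lemma continuous_residual (R : realType) (n m : nat)
    (f : ('I_n -> R) -> 'I_n -> R) (r : R) (i : 'I_n) :
  monotone_form m f ->
  continuous (fun x : 'rV[R]_n => r * x ord0 i ^+ m - f (x ord0) i).
Proof.
move=> mf x.
apply: (@cvgB R R^o _ (nbhs x) _ (fun x : 'rV[R]_n => r * x ord0 i ^+ m)).
  apply: (@cvgM R _ (nbhs x) _ (cst r) (fun x : 'rV[R]_n => x ord0 i ^+ m)).
    exact: cvg_cst.
  by apply: continuous_exp; exact: coord_continuous.
exact: (form_cont mf).
Qed.

(** A maximizer [x] must be an eigenvector: otherwise the vector of m-th roots of [f x] would
    satisfy the constraint with a larger constant. Positivity of [x] follows since a strictly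
    monotone form is positive at nonzero nonnegative vectors. *)
Lemma wielandt (R : realType) (n m : nat) (f : ('I_n -> R) -> 'I_n -> R) :
  (0 < n)%N -> (0 < m)%N -> monotone_form m f ->
  (forall x y, (forall k, 0 <= x k <= y k) -> (exists k, x k != y k) ->
     forall i, f x i < f y i) ->
  exists r u, [/\ 0 <= r, simplex u, forall i, 0 < u i
                & forall i, f u i = r * u i ^+ m].
Proof.
move=> n0 m0 mf sf.
pose i0 := Ordinal n0.
pose S : set R := [set r | 0 <= r /\
  exists2 x, simplex x & forall i, r * x i ^+ m <= f x i].
have fpos x i : (forall k, 0 <= x k) -> (exists k, x k != 0) -> 0 < f x i.
  move=> x0 [k xk].
  have z0 : forall k, 0 <= (fun=> 0 : R) k <= x k by move=> ?; rewrite lexx x0.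
  apply: le_lt_trans (form_ge0 mf i _) (sf _ _ z0 _ i) => //.
  by exists k; rewrite eq_sym.
have S0 : S 0.
  split=> //; exists (fun i => (i == i0)%:R) => [|i].
    split=> [i|]; first by rewrite ler0n.
    by rewrite (bigD1 i0)//= big1 ?addr0 ?eqxx// => i /negbTE ->.
  by rewrite mul0r (form_ge0 mf)// => k; rewrite ler0n.
have hS : has_sup S.
  split; first by exists 0.
  (* The all-ones vector serves as the positive comparison vector. *)
  exists (\sum_i f (fun=> 1) i) => r [_ [x sx rx]].
  apply: (@collatz_wielandt_le _ _ _ _ _ _ x (fun=> 1) mf) => //.
  - by case: sx.
  - exact: simplex_neq0 sx.
  - move=> i; rewrite expr1n mulr1 (bigD1 i)//= lerDl sumr_ge0// => k _.
    exact: (form_ge0 mf).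
have normD_ge0 (a : R) : 0 <= `|a| + a.
  by have := ler_norm (- a); rewrite normrN; lra.
set r := sup S.
have rge q : S q -> q <= r by move=> Sq; apply: ub_le_sup => //; case: hS.
have r0 : 0 <= r by exact: rge.
(* The supremum is attained: [|a| + a] is twice the positive part of [a], so the sum vanishes
   exactly when all constraints hold. The factor 2 explains the slack [e / 2] below. *)
have [x sx Fx] : exists2 x, simplex x &
    \sum_i (`|r * x i ^+ m - f x i| + (r * x i ^+ m - f x i)) = 0.
  apply: (@simplex_zero _ _
    (fun x => \sum_i (`|r * x i ^+ m - f x i| + (r * x i ^+ m - f x i)))).
  - apply: continuous_sum => i.
    have cg := @continuous_residual _ _ _ _ r i mf.
    move=> x; apply: (@cvgD R R^o _ (nbhs x) _
      (fun x : 'rV[R]_n => `|r * x ord0 i ^+ m - f (x ord0) i|));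
      last exact: cg.
    by apply: (@cvg_norm R R^o); exact: cg.
  - by move=> x; apply: sumr_ge0 => i _.
  - move=> e e0.
    have e20 : 0 < e / 2 by rewrite divr_gt0.
    have [q Sq rq] := sup_adherent e20 hS.
    have qr := rge q Sq.
    case: Sq => q0 [x sx qx]; exists x => //.
    have [x0 x1] := sx.
    apply: (@le_trans _ _ (\sum_i e * x i)); last first.
      by rewrite -mulr_sumr x1 mulr1.
    apply: ler_sum => i _.
    have xm : x i ^+ m <= x i.
      by rewrite -[leRHS]expr1 ler_wiXn2l// simplex_le1.
    have xm0 : 0 <= x i ^+ m by exact: exprn_ge0.
    have h1 : (r - q) * x i ^+ m <= e / 2 * x i.
      by apply: ler_pM => //; rewrite ?subr_ge0// lerBlDr addrC -lerBlDr ltW.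
    have h2 : r * x i ^+ m - f x i <= e / 2 * x i.
      by apply: le_trans h1; rewrite mulrBl lerD2l lerN2 qx.
    have xi0 := x0 i.
    have [h|h] := lerP 0 (r * x i ^+ m - f x i).
      by rewrite ger0_norm//; lra.
    by rewrite ltr0_norm// addNr mulr_ge0// ltW.
have [x0 x1] := sx.
have rx i : r * x i ^+ m <= f x i.
  rewrite -subr_le0.
  have : `|r * x i ^+ m - f x i| + (r * x i ^+ m - f x i) = 0.
    apply/eqP; move/eqP : Fx; rewrite psumr_eq0; last first.
      by move=> k _.
    by move/allP => /(_ i); rewrite mem_index_enum /= => /(_ isT).
  by have := normr_ge0 (r * x i ^+ m - f x i); lra.
pose p : R := m%:R^-1.
have rootK c : 0 <= c -> (c `^ p) ^+ m = c.
  move=> c0; rewrite -powR_mulrn ?powR_ge0// -powRrM mulVf ?pnatr_eq0 -?lt0n//.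
  by rewrite powRr1.
(* Roots are chosen so that [y ^ m = f x] and [z ^ m = r x ^ m]; hence [z <= y] and
   [f z = r f x = r y ^ m]. If [z] differs from [y], strict monotonicity gives [r y ^ m < f y]. *)
pose y i := f x i `^ p.
pose z i := r `^ p * x i.
have xn0 := simplex_neq0 sx.
have fx0 i : 0 < f x i by exact: fpos.
have y0 i : 0 < y i by rewrite powR_gt0.
have ym i : y i ^+ m = f x i by rewrite rootK// ltW.
have zm i : z i ^+ m = r * x i ^+ m by rewrite exprMn rootK.
have zy k : 0 <= z k <= y k.
  have z0 : 0 <= z k by rewrite mulr_ge0// powR_ge0.
  rewrite z0/= -(@ler_pXn2r _ m)// ?nnegrE//; [by rewrite zm ym|exact: ltW].
have [zney|zey] := pselect (exists k, z k != y k); last first.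
  have fxE i : f x i = r * x i ^+ m.
    rewrite -ym -zm; congr (_ ^+ _); apply/esym/eqP/negPn/negP => zyi.
    by apply: zey; exists i.
  exists r, x; split=> // i; rewrite lt_neqAle x0 andbT eq_sym.
  apply/eqP => xi0; have := fx0 i.
  by rewrite fxE xi0 expr0n gtn_eqF// mulr0 ltxx.
have := sf _ _ zy zney => {}sf.
have {}sf i : r * y i ^+ m < f y i.
  by apply: le_lt_trans (sf i); rewrite ym (form_scale mf) rootK.
(* The least ratio exceeds [r], yet the normalized [y] places it in [S], contradicting the
   supremum. *)
pose q i := f y i / y i ^+ m.
have [i _ minq] := @arg_minP _ R _ i0 predT q isT.
have ym0 k : 0 < y k ^+ m by rewrite exprn_gt0.
have rq : r < q i by rewrite ltr_pdivlMr.
suff /rge : S (q i) by rewrite leNgt rq.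
split; first by apply: le_trans (ltW rq).
have [||s0 sy] := @simplex_normalize _ _ y i0.
- by move=> k; exact: ltW.
- by rewrite gt_eqF.
eexists; first exact: sy.
move=> k; rewrite (form_scale mf) exprMn mulrCA.
apply: ler_wpM2l; first by rewrite exprn_ge0// invr_ge0 ltW.
by rewrite -ler_pdivlMr//; exact: minq.
Qed.

Definition perturb (R : realType) (n m : nat) (f : ('I_n -> R) -> 'I_n -> R)
    (e : R) : ('I_n -> R) -> 'I_n -> R :=
  fun x i => f x i + e * (\sum_k x k) ^+ m.

Lemma perturb_form (R : realType) (n m : nat) (f : ('I_n -> R) -> 'I_n -> R)
    (e : R) :
  0 <= e -> monotone_form m f -> monotone_form m (perturb m f e).
Proof.
move=> e0 mf; split.
- move=> i x.
  apply: (@cvgD R R^o _ (nbhs x) _ (fun x : 'rV[R]_n => f (x ord0) i)).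
    exact: (form_cont mf).
  apply: (@cvgM R _ (nbhs x) _ (cst e)
    (fun x : 'rV[R]_n => (\sum_k x ord0 k) ^+ m)); first exact: cvg_cst.
  apply: continuous_exp; apply: continuous_sum => k; exact: coord_continuous.
- move=> x i x0; rewrite addr_ge0 ?(form_ge0 mf)// mulr_ge0// exprn_ge0//.
  by rewrite sumr_ge0.
- move=> x y i xy; apply: lerD; first exact: (form_le mf).
  have x0 k : 0 <= x k by case/andP: (xy k).
  have lexy k : x k <= y k by case/andP: (xy k).
  apply: ler_wpM2l => //; apply: lerXn2r; rewrite ?nnegrE ?sumr_ge0//.
    by move=> k _; apply: le_trans (lexy k).
  exact: ler_sum.
- move=> c x i; rewrite /perturb (form_scale mf) -mulr_sumr exprMn.
  by rewrite mulrDr mulrCA.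
Qed.

Lemma perturb_strict (R : realType) (n m : nat) (f : ('I_n -> R) -> 'I_n -> R)
    (e : R) (x y : 'I_n -> R) :
  (0 < m)%N -> 0 < e -> monotone_form m f ->
  (forall k, 0 <= x k <= y k) -> (exists k, x k != y k) ->
  forall i, perturb m f e x i < perturb m f e y i.
Proof.
move=> m0 e0 mf xy [k xyk] i.
apply: ler_ltD; first exact: (form_le mf).
have x0 j : 0 <= x j by case/andP: (xy j).
have lexy j : x j <= y j by case/andP: (xy j).
have lts : \sum_j x j < \sum_j y j.
  rewrite (bigD1 k)//= [ltRHS](bigD1 k)//= ltr_leD ?ler_sum//.
  by rewrite lt_neqAle xyk lexy.
by rewrite ltr_pM2l// ltrXn2r ?lts// ?lt0n_neq0// sumr_ge0.
Qed.

(** Here [r] is the infimum of the eigenvalues of all perturbed forms. Perturbed eigenvectors with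
    eigenvalue near [r] are approximate eigenvectors of [f], and also positive supersolutions
    because [f <= perturb m f e]. *)
Lemma perron_frobenius (R : realType) (n m : nat)
    (f : ('I_n -> R) -> 'I_n -> R) :
  (0 < n)%N -> (0 < m)%N -> monotone_form m f ->
  exists r, [/\ 0 <= r,
    exists2 v, simplex v & forall i, f v i = r * v i ^+ m
    & forall e, 0 < e -> exists2 u, forall i, 0 < u i
                                  & forall i, f u i <= (r + e) * u i ^+ m].
Proof.
move=> n0 m0 mf.
pose E : set R := [set r | exists e u, [/\ 0 < e, 0 <= r, simplex u,
  forall i, 0 < u i & forall i, perturb m f e u i = r * u i ^+ m]].
have mfe e : 0 < e -> monotone_form m (perturb m f e).
  by move=> e0; apply: perturb_form => //; exact: ltW.
have ex e : 0 < e -> exists r u, [/\ 0 <= r, simplex u,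
    forall i, 0 < u i & forall i, perturb m f e u i = r * u i ^+ m].
  move=> e0; apply: wielandt => //; first exact: mfe.
  by move=> x y; exact: perturb_strict.
have hE : has_inf E.
  split; last by exists 0 => r [e [u []]].
  by have [r [u [r0 su u0 ur]]] := ex 1 ltr01; exists r, 1, u.
set r := inf E.
have rle q : E q -> r <= q by move=> Eq; apply: ge_inf => //; case: hE.
have r0 : 0 <= r by apply: lb_le_inf; [case: hE|move=> q [e [u []]]].
have small d : 0 < d -> exists e q u, [/\ 0 < e <= d, r <= q <= r + d,
    simplex u, forall i, 0 < u i & forall i, perturb m f e u i = q * u i ^+ m].
  move=> d0; have [q [e [u [e0 q0 su u0 uq]]] qr] := inf_adherent d0 hE.
  (* Shrinking the perturbation does not raise the eigenvalue, by [collatz_wielandt_le], so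
     perturbation and eigenvalue can be controlled together. *)
  have e'0 : 0 < Num.min e d by rewrite lt_min e0.
  have [q' [u' [q'0 su' u'0 u'q']]] := ex _ e'0.
  exists (Num.min e d), q', u'; split=> //.
    by rewrite e'0 ge_min lexx orbT.
  rewrite rle; last by exists (Num.min e d), u'.
  apply: le_trans (ltW qr).
  apply: (@collatz_wielandt_le _ _ _ _ _ _ u' u (mfe _ e'0)) => //.
  - by case: su'.
  - exact: simplex_neq0 su'.
  - by move=> i; rewrite u'q'.
  - move=> i; rewrite -uq lerD2l ler_wpM2r ?ge_min ?lexx//.
    by rewrite exprn_ge0// sumr_ge0//; case: su.
exists r; split=> //.
- have [v sv vr] : exists2 v, simplex v & \sum_i `|r * v i ^+ m - f v i| = 0.
    apply: (@simplex_zero _ _ (fun v => \sum_i `|r * v i ^+ m - f v i|)).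
    + apply: continuous_sum => i x.
      apply: (@cvg_norm R R^o _ (nbhs x) _
        (fun x : 'rV[R]_n => r * x ord0 i ^+ m - f (x ord0) i)).
      exact: continuous_residual.
    + by move=> v; apply: sumr_ge0.
    (* Each coordinate has error at most [d + d * u i]: the perturbation plus the eigenvalue gap. As
       [u] sums to 1, the total is [n.+1] times [d]. *)
    + move=> e e0; have d0 : 0 < e / (n.+1)%:R by rewrite divr_gt0// ltr0Sn.
      have [e' [q [u [/andP[e'0 e'd] /andP[rq qr] su u0 uq]]]] := small _ d0.
      exists u => //; have [_ u1] := su.
      have ui0 i : 0 <= u i by exact: ltW.
      set d := e / _ in d0 e'd qr.
      apply: (@le_trans _ _ (\sum_i (d + d * u i))).
        apply: ler_sum => i _.
        rewrite distrC.
        have -> : f u i - r * u i ^+ m = (q - r) * u i ^+ m - e'.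
          have := uq i; rewrite /perturb u1 expr1n mulr1.
          by move=> /(canRL (addrK _)) ->; rewrite mulrBl addrAC.
        apply: le_trans (ler_normB _ _) _.
        rewrite addrC (gtr0_norm e'0) lerD// ger0_norm; last first.
          by rewrite mulr_ge0 ?subr_ge0// exprn_ge0.
        apply: ler_pM => //; rewrite ?subr_ge0 ?exprn_ge0//.
          by rewrite lerBlDl.
        by rewrite -[leRHS]expr1 ler_wiXn2l// simplex_le1.
      rewrite big_split/= sumr_const card_ord -mulr_sumr u1 mulr1 -mulrSr.
      by rewrite -mulr_natr divfK// pnatr_eq0.
  exists v => // i; apply/eqP; rewrite eq_sym -subr_eq0 -normr_eq0.
  move/eqP: vr; rewrite psumr_eq0// => /allP /(_ i).
  by rewrite mem_index_enum /= => /(_ isT).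
- move=> d d0.
  have [e [q [u [/andP[e0 _] /andP[_ qr] su u0 uq]]]] := small d d0.
  exists u => // i; apply: (@le_trans _ _ (perturb m f e u i)).
    rewrite lerDl mulr_ge0 ?(ltW e0)// exprn_ge0// sumr_ge0//.
    by case: su.
  by rewrite uq ler_wpM2r// exprn_ge0// ltW.
Qed.

(** * The spectral radius of a nonnegative tensor *)

Definition tensor_form (K : comNzRingType) (n d : nat) (t : tensor K n d)
    (x : 'I_n -> K) (i : 'I_n) : K :=
  \sum_(J : d.-1.-tuple 'I_n) t i J * \prod_(j <- J) x j.

Lemma tensor_appE (K : comNzRingType) (n d : nat) (t : tensor K n d)
    (x : 'cV[K]_n) i :
  tensor_app t x i 0 = tensor_form t (fun j => x j 0) i.
Proof. by rewrite mxE. Qed.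

Lemma tensor_monotone_form (R : realType) (n d : nat) (t : tensor R n d) :
  nonneg_tensor t -> monotone_form d.-1 (tensor_form t).
Proof.
move=> t0; split.
- move=> i; apply: continuous_sum => J x.
  apply: (@cvgM R _ (nbhs x) _ (cst (t i J))
    (fun x : 'rV[R]_n => \prod_(j <- J) x ord0 j)); first exact: cvg_cst.
  by apply: continuous_prod => j; exact: coord_continuous.
- move=> x i x0; apply: sumr_ge0 => J _; rewrite mulr_ge0// prodr_ge0//.
- move=> x y i xy; apply: ler_sum => J _; apply: ler_wpM2l => //.
  by apply: ler_prod => j _; exact: xy.
- move=> c x i; rewrite /tensor_form mulr_sumr; apply: eq_bigr => J _.
  rewrite big_split/= mulrCA; congr (_ * _).
  by rewrite big_const_seq count_predT size_tuple iter_mulr_1.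
Qed.

Local Open Scope complex_scope.

Lemma spectral_radius_eq (R : realType) (n d : nat) (t : tensor R n d) (r : R) :
  nonneg_tensor t -> 0 <= r ->
  (exists2 v, simplex v & forall i, tensor_form t v i = r * v i ^+ d.-1) ->
  (forall e, 0 < e -> exists2 u, forall i, 0 < u i
     & forall i, tensor_form t u i <= (r + e) * u i ^+ d.-1) ->
  spectral_radius t = r.
Proof.
move=> t0 r0 [v sv vr] ur.
have max_r : is_maximum (eigenvalue_moduli t) r.
  split.
    exists r%:C; last by rewrite ger0_norm// ler0c.
    exists (\col_i (v i)%:C).
      have [i vi] := simplex_neq0 sv.
      apply/eqP => /matrixP /(_ i 0); rewrite !mxE => /complexI vi0.
      by rewrite vi0 eqxx in vi.
    apply/matrixP => i j; rewrite ord1 !mxE -rmorphXn -rmorphM -vr rmorph_sum.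
    apply: eq_bigr => J _; rewrite rmorphM rmorph_prod; congr (_ * _).
    by apply: eq_bigr => k _; rewrite mxE.
  move=> q [l [x x0 xl] lq].
  apply/ler_addgt0Pr => e e0; have [u u0 ue] := ur e e0.
  (* The modulus vector of [x], cast back to the reals. By the triangle inequality it satisfies
     [q * y i ^+ d.-1 <= tensor_form t y i]. *)
  pose y i : R := complex.Re `|x i 0|.
  have yC i : (y i)%:C = `|x i 0| by rewrite /y normc_def.
  have y0 i : 0 <= y i by rewrite -ler0c yC.
  apply: (@collatz_wielandt_le _ _ _ _ _ _ y u (tensor_monotone_form t0)) => //.
    have [i xi] : exists i, x i 0 != 0.
      apply/existsP; apply: contraNT x0; rewrite negb_exists => /forallP x0.
      apply/eqP/matrixP => i j; rewrite ord1 mxE; apply/eqP.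
      by have := x0 i; rewrite negbK.
    exists i; apply/eqP => yi.
    by move/eqP: (yC i); rewrite yi eq_sym normr_eq0 (negbTE xi).
  move=> i; rewrite -lecR rmorphM rmorphXn/= yC -lq -normrX -normrM.
  have -> : l * x i 0 ^+ d.-1 = tensor_app (tensor_complex t) x i 0.
    by rewrite xl !mxE.
  rewrite tensor_appE; apply: le_trans (ler_norm_sum _ _ _) _.
  rewrite rmorph_sum; apply: ler_sum => J _.
  rewrite normrM rmorphM rmorph_prod normr_prod ger0_norm ?ler0c//.
(* A maximum is unique, so [xget] can only pick [r]. *)
rewrite /spectral_radius; case: xgetP => [s _ [Ss us]|/(_ r)//].
case: max_r => Sr ubr; apply/eqP; rewrite eq_le us// ubr//.
Qed.

Local Close Scope complex_scope.

Lemma spectral_radius_perron (R : realType) (n d : nat) (t : tensor R n d) :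
  (0 < n)%N -> (1 < d)%N -> nonneg_tensor t ->
  [/\ 0 <= spectral_radius t,
    exists2 v, simplex v
      & forall i, tensor_form t v i = spectral_radius t * v i ^+ d.-1
    & forall e, 0 < e -> exists2 u, forall i, 0 < u i
      & forall i, tensor_form t u i <= (spectral_radius t + e) * u i ^+ d.-1].
Proof.
move=> n0 d1 t0.
have m0 : (0 < d.-1)%N by case: d d1 {t t0} => [|[]].
have [r [r0 rv ru]] := perron_frobenius n0 m0 (tensor_monotone_form t0).
by have -> := spectral_radius_eq t0 r0 rv ru.
Qed.

(** * Entropy of occupation measures *)

Lemma big_ohead (R : nmodType) (n m : nat) (F : m.-tuple 'I_n -> R) :
  (0 < m)%N ->
  \sum_j \sum_(J : m.-tuple 'I_n | ohead J == Some j) F J = \sum_J F J.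
Proof.
move=> m0; rewrite (exchange_big_dep xpredT)//=; apply: eq_bigr => J _.
have [j Jj] : exists j, ohead J = Some j.
  by case: J m0 => -[|j s]/= /eqP <-// _; exists j.
rewrite (big_pred1 j)// => k /=; rewrite Jj; apply/eqP/eqP => [[]//|->//].
Qed.

(** Each of the [m] positions contributes as much as position 0: swap the two by a transposition,
    which leaves [a] unchanged. *)
Lemma sum_symmetric (R : comNzRingType) (n m : nat) (a : m.-tuple 'I_n -> R)
    (g : 'I_n -> R) :
  (0 < m)%N -> (forall J J' : m.-tuple 'I_n, perm_eq J J' -> a J = a J') ->
  \sum_J a J * (\sum_(k <- J) g k) =
  m%:R * \sum_j (\sum_(J : m.-tuple 'I_n | ohead J == Some j) a J) * g j.
Proof.
move=> m0 symm; pose p0 := Ordinal m0.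
transitivity (\sum_(p < m) \sum_(J : m.-tuple 'I_n) a J * g (tnth J p0)).
  under eq_bigr do rewrite big_tuple mulr_sumr.
  rewrite exchange_big/=; apply: eq_bigr => p _.
  pose h (J : m.-tuple 'I_n) := [tuple tnth J (tperm p0 p k) | k < m].
  have hK : involutive h.
    by move=> J; apply: eq_from_tnth => k; rewrite !tnth_mktuple tpermK.
  rewrite (reindex_inj (inv_inj hK)); apply: eq_bigr => J _.
  rewrite tnth_mktuple tpermR; congr (_ * _); apply: symm.
  by apply/tuple_permP; exists (tperm p0 p).
rewrite sumr_const card_ord -[LHS]mulr_natl; congr (_ * _).
rewrite -(big_ohead _ m0); apply: eq_bigr => j _; rewrite mulr_suml.
apply: eq_bigr => J /eqP Jj; congr (_ * g _).
by case: J Jj => -[|j' s] sJ//= [<-]; rewrite (tnth_nth j').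
Qed.

(** By [sum_symmetric] the sum over [J] amounts to [d.-1] times the integral of [g] against the
    second marginal, which equals the first. *)
Lemma occupation_balance (R : realType) (n d : nat) (mu : tensor R n d)
    (g : 'I_n -> R) :
  (1 < d)%N -> occupation_measures mu ->
  \sum_i \sum_(J : d.-1.-tuple 'I_n)
    mu i J * (d.-1%:R * g i - \sum_(k <- J) g k) = 0.
Proof.
move=> d1 [[symm _] _ marg].
have m0 : (0 < d.-1)%N by case: d d1 {mu symm marg} => [|[]].
under eq_bigr do under eq_bigr do rewrite mulrBr.
under eq_bigr do rewrite sumrB (sum_symmetric _ m0 (symm _)).
rewrite sumrB; apply/eqP; rewrite subr_eq0; apply/eqP.
rewrite -[RHS]mulr_sumr [X in _ = _ * X]exchange_big/= mulr_sumr.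
apply: eq_bigr => i _.
by rewrite -mulr_suml -[X in X * _]/(marginal1 mu i) marg -mulr_suml mulrCA.
Qed.

(** Positivity is asked only on [s], as an eigenvector may vanish elsewhere. *)
Lemma ln_prod (R : realType) (I : eqType) (s : seq I) (u : I -> R) :
  {in s, forall k, 0 < u k} ->
  0 < \prod_(k <- s) u k /\ ln (\prod_(k <- s) u k) = \sum_(k <- s) ln (u k).
Proof.
elim: s => [|k s ih] us; first by rewrite !big_nil ltr01 ln1.
have [P0 lnP] := ih (fun j js => us j (@mem_behead _ (k :: s) j js)).
have uk : 0 < u k by rewrite us// mem_head.
by rewrite !big_cons mulr_gt0// lnM ?posrE// lnP.
Qed.

(* [ln y <= y - 1] with
   [y = marginal1 mu i * t i J * u_J / (mu i J * r * u_i ^ (d-1))];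
   the weights [u] drop out of the sum
   by [occupation_balance]. *)
Lemma entropy_le (R : realType) (n d : nat) (t mu : tensor R n d)
    (u : 'I_n -> R) (r : R) :
  (1 < d)%N -> nonneg_tensor t -> occupation_measures mu -> 0 < r ->
  (forall i, 0 < u i) -> (forall i, tensor_form t u i <= r * u i ^+ d.-1) ->
  (entropy t mu <= (ln r)%:E)%E.
Proof.
move=> d1 t0 omu r0 u0 ur.
have [[_ mu0] mu1 _] := omu.
have marg0 i : 0 <= marginal1 mu i by exact: sumr_ge0.
pose g i := ln (u i).
pose k i J := t i J * \prod_(j <- J) u j / (r * u i ^+ d.-1).
have prod0 (J : d.-1.-tuple 'I_n) : 0 < \prod_(j <- J) u j by exact: prodr_gt0.
have um0 i : 0 < u i ^+ d.-1 by exact: exprn_gt0.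
have k0 i J : 0 <= k i J by rewrite divr_ge0 ?mulr_ge0// ltW// mulr_gt0.
(* The bound [ln y <= y - 1] multiplied by [mu i J] and solved for the entropy term; note
   [mu i J * y = marginal1 mu i * k i J]. *)
pose c i J := mu i J * ln r + mu i J * (d.-1%:R * g i - \sum_(j <- J) g j)
              + marginal1 mu i * k i J - mu i J.
have term i J : (entropy_term t mu i J <= (c i J)%:E)%E.
  rewrite /entropy_term /c; have [->|muN0] := eqVneq (mu i J) 0.
    by rewrite !mul0r subr0 !add0r lee_fin mulr_ge0.
  have mup : 0 < mu i J by rewrite lt_neqAle eq_sym muN0 mu0.
  have margp : 0 < marginal1 mu i.
    by apply: lt_le_trans mup _; rewrite /marginal1 (bigD1 J)//= lerDl sumr_ge0.
  have [tiJ|tN0] := eqVneq (t i J) 0.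
    by rewrite tiJ mulr0 mul0r /= lexx gt0_muleNy ?leNye// lte_fin.
  have tp : 0 < t i J by rewrite lt_neqAle eq_sym tN0 t0.
  have xp : 0 < marginal1 mu i * t i J / mu i J by rewrite divr_gt0// mulr_gt0.
  rewrite lne_EFin// lee_fin.
  have rup : 0 < r * u i ^+ d.-1 by rewrite mulr_gt0.
  pose y := marginal1 mu i * t i J / mu i J *
    (\prod_(j <- J) u j / (r * u i ^+ d.-1)).
  have qp : 0 < \prod_(j <- J) u j / (r * u i ^+ d.-1) by rewrite divr_gt0.
  have y0 : 0 < y by exact: mulr_gt0.
  have yE : marginal1 mu i * k i J = mu i J * y.
    by rewrite /k /y; field; rewrite ?gt_eqF.
  have lny : ln y = ln (marginal1 mu i * t i J / mu i J) -
      (ln r + (d.-1%:R * g i - \sum_(j <- J) g j)).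
    have [_ lnJ] := @ln_prod _ _ J u (fun j _ => u0 j).
    rewrite /y lnM ?posrE// [ln (_ / (r * _))]ln_div ?posrE//.
    by rewrite lnJ [ln (r * _)]lnM ?posrE// lnXn// /g mulr_natl; ring.
  have : ln y <= y - 1.
    by have := @le_ln1Dx R (y - 1); rewrite [1 + _]addrC subrK; apply; lra.
  rewrite lny yE => /(ler_wpM2l (ltW mup)).
  by set b := _ - \sum_(j <- J) _; set l := ln (_ / _) => H; lra.
apply: (@le_trans _ _ (\sum_i \sum_(J : d.-1.-tuple 'I_n) (c i J)%:E)%E).
  by apply: lee_sum => i _; apply: lee_sum => J _.
under eq_bigr do rewrite sumEFin.
rewrite sumEFin lee_fin /c.
under eq_bigr do rewrite sumrB big_split/= big_split/= -mulr_suml -mulr_sumr.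
rewrite sumrB mu1 big_split/= big_split/= (occupation_balance _ d1 omu) addr0.
(* Since [u] is a supersolution, each row of [k] sums to at most 1, so the last two terms of [c]
   have nonpositive total. *)
rewrite -mulr_suml mu1 mul1r lerBlDr lerD2l -mu1; apply: ler_sum => i _.
rewrite -[leRHS]mulr1; apply: ler_wpM2l => //.
by rewrite -mulr_suml ler_pdivrMr ?mul1r ?mulr_gt0// ur.
Qed.

(** * Measures built from Markov kernels, and attainment of the maximum *)

(** The first index has law [p]; the other factor is the conditional law of [J] given [i],
    normalized by the eigenvalue equation. Where [v i = 0], division by zero makes it 0 when
    [d.-1 > 0]. *)
Definition kernel_measure (R : realType) (n d : nat) (t : tensor R n d)
    (r : R) (v p : 'I_n -> R) : tensor R n d :=
  fun i J => p i * (t i J * \prod_(j <- J) v j / (r * v i ^+ d.-1)).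

(** On the support of this measure the argument of the logarithm is exactly [r * v i ^+ d.-1] over
    the product of [v] along [J]; [occupation_balance] then removes [v] and leaves [ln r]. *)
Lemma kernel_measure_entropy (R : realType) (n d : nat) (t : tensor R n d)
    (r : R) (v p : 'I_n -> R) :
  (1 < d)%N -> ps_nonneg t -> 0 < r -> (forall i, 0 <= v i) ->
  (forall i, tensor_form t v i = r * v i ^+ d.-1) ->
  simplex p -> (forall i, v i = 0 -> p i = 0) ->
  (forall j, marginal2 (kernel_measure t r v p) j = p j) ->
  occupation_measures (kernel_measure t r v p) /\
  entropy t (kernel_measure t r v p) = (ln r)%:E.
Proof.
move=> d1 [tsym t0] r0 v0 vr [p0 p1] vp stat; set mu := kernel_measure t r v p.
have marg i : marginal1 mu i = p i.
  rewrite /marginal1 /mu /kernel_measure -mulr_sumr -mulr_suml.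
  rewrite -[X in _ * (X / _)]/(tensor_form t v i) vr.
  have [/vp ->|vi] := eqVneq (v i) 0; first by rewrite mul0r.
  by rewrite divff ?mulr1// mulf_neq0 ?expf_neq0// gt_eqF.
have omu : occupation_measures mu.
  split; [split| |].
  - move=> i J J' JJ'; rewrite /mu /kernel_measure (tsym _ _ _ JJ').
    by rewrite (perm_big _ JJ').
  - move=> i J; rewrite mulr_ge0// divr_ge0 ?mulr_ge0 ?prodr_ge0 ?exprn_ge0//.
    exact: ltW.
  - by rewrite -p1; apply: eq_bigr => i _; rewrite -marg.
  - by move=> j; rewrite marg stat.
split=> //.
have [_ mu1 _] := omu.
pose g i := ln (v i).
pose c i J := mu i J * ln r + mu i J * (d.-1%:R * g i - \sum_(j <- J) g j).
transitivity (\sum_i \sum_(J : d.-1.-tuple 'I_n) (c i J)%:E)%E; last first.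
  under eq_bigr do rewrite sumEFin.
  rewrite sumEFin /c; under eq_bigr do rewrite big_split/= -mulr_suml.
  rewrite big_split/= (occupation_balance _ d1 omu) addr0 -mulr_suml.
  by rewrite mu1 mul1r.
apply: eq_bigr => i _; apply: eq_bigr => J _.
rewrite /entropy_term /c; have [->|muN0] := eqVneq (mu i J) 0.
  by rewrite !mul0r addr0.
(* A nonzero entry forces [v] to be positive at [i] and along [J], so all logarithms split. *)
have := muN0; rewrite /mu /kernel_measure mulf_eq0 negb_or => /andP[pN0].
rewrite mulf_eq0 negb_or mulf_eq0 negb_or => /andP[/andP[tN0 PN0] _].
have vi : v i != 0 by apply: contra_neq pN0 => /vp.
have vip : 0 < v i by rewrite lt_neqAle eq_sym vi v0.
have vJ : {in J, forall k, 0 < v k}.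
  move=> k kJ; rewrite lt_neqAle v0 andbT eq_sym; apply: contra_neq PN0 => vk.
  by apply/eqP; rewrite prodf_seq_eq0; apply/hasP; exists k => //=; apply/eqP.
have [PJ lnJ] := ln_prod vJ.
have xE : marginal1 mu i * t i J / mu i J =
    r * v i ^+ d.-1 / \prod_(k <- J) v k.
  rewrite marg /mu /kernel_measure; field.
  by rewrite pN0 tN0 PN0 expf_neq0//= gt_eqF.
have vm0 : 0 < v i ^+ d.-1 by rewrite exprn_gt0.
rewrite xE lne_EFin ?divr_gt0 ?mulr_gt0// -EFinM; congr EFin.
rewrite ln_div ?posrE ?mulr_gt0// lnM ?posrE// lnXn// lnJ -mulr_natl /g.
by ring.
Qed.

(** The constant vector is fixed by [B], so some nonzero row vector [w] is fixed too. The triangle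
    inequality gives [|w| <= |w| B] entrywise; both sides have the same total since rows sum to 1,
    so they agree and [|w|] can be normalized. *)
Lemma stationary_distribution (R : realType) (n : nat) (B : 'M[R]_n) :
  (0 < n)%N -> (forall i j, 0 <= B i j) -> (forall i, \sum_j B i j = 1) ->
  exists2 p, simplex p & forall j, \sum_i p i * B i j = p j.
Proof.
move=> n0 B0 B1; pose i0 := Ordinal n0.
have : \det (1%:M - B) == 0.
  rewrite -det_tr; apply/det0P; exists (const_mx 1).
    by apply/eqP => /matrixP /(_ 0 i0)/eqP; rewrite !mxE oner_eq0.
  apply/matrixP => i j; rewrite !mxE.
  under eq_bigr do rewrite !mxE mul1r.
  rewrite sumrB B1 (bigD1 j)//= eqxx big1 ?addr0 ?subrr// => k kj.
  by rewrite eq_sym (negbTE kj).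
case/det0P => w wN0 wB.
have wE j : w 0 j = \sum_i w 0 i * B i j.
  move/matrixP: wB => /(_ 0 j); rewrite mulmxBr mulmx1 !mxE => /eqP.
  by rewrite subr_eq0 => /eqP.
have le j : `|w 0 j| <= \sum_i `|w 0 i| * B i j.
  rewrite [in leLHS]wE; apply: le_trans (ler_norm_sum _ _ _) _.
  by apply: ler_sum => i _; rewrite normrM (ger0_norm (B0 _ _)).
have eq0 : \sum_j (\sum_i `|w 0 i| * B i j - `|w 0 j|) = 0.
  rewrite sumrB exchange_big/=; apply/eqP; rewrite subr_eq0; apply/eqP.
  by apply: eq_bigr => i _; rewrite -mulr_sumr B1 mulr1.
have absE j : \sum_i `|w 0 i| * B i j = `|w 0 j|.
  apply/eqP; rewrite -subr_eq0; move/eqP: eq0; rewrite psumr_eq0.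
    by move=> /allP /(_ j); rewrite mem_index_enum /= => /(_ isT).
  by move=> k _; rewrite subr_ge0.
have [i wi] : exists i, w 0 i != 0.
  apply/existsP; apply: contraNT wN0; rewrite negb_exists => /forallP w0.
  apply/eqP/matrixP => i j; rewrite ord1 mxE; apply/eqP.
  by have := w0 j; rewrite negbK.
have [||s0 sp] := @simplex_normalize _ _ (fun k => `|w 0 k|) i.
- by move=> k.
- by rewrite normr_eq0.
eexists; first exact: sp.
by move=> j /=; rewrite -absE mulr_sumr; apply: eq_bigr => k _; rewrite mulrA.
Qed.

(* Off the support of [v] the Markov chain jumps to a fixed state of the
   support, so that its stationary distribution vanishes where [v] does. *)
Lemma eigenvector_occupation (R : realType) (n d : nat) (t : tensor R n d)
    (r : R) (v : 'I_n -> R) :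
  (1 < d)%N -> ps_nonneg t -> 0 < r -> (forall i, 0 <= v i) ->
  (exists i, v i != 0) -> (forall i, tensor_form t v i = r * v i ^+ d.-1) ->
  exists2 mu, occupation_measures mu & entropy t mu = (ln r)%:E.
Proof.
move=> d1 tps r0 v0 [i0 vi0] vr; have [_ t0] := tps.
have m0 : (0 < d.-1)%N by case: d d1 {t tps vr t0} => [|[]].
pose k i J := t i J * \prod_(j <- J) v j / (r * v i ^+ d.-1).
have k0 i J : 0 <= k i J.
  by rewrite divr_ge0 ?mulr_ge0 ?prodr_ge0 ?exprn_ge0// ltW.
pose B := \matrix_(i, j) if v i == 0 then (j == i0)%:R
  else \sum_(J : d.-1.-tuple 'I_n | ohead J == Some j) k i J.
have [|i j|i|p sp pB] := @stationary_distribution _ _ B.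
- exact: leq_ltn_trans (ltn_ord i0).
- by rewrite mxE; case: ifP => _; [rewrite ler0n|rewrite sumr_ge0].
- under eq_bigr do rewrite mxE.
  have [vi|vi] := eqVneq (v i) 0.
    by rewrite (bigD1 i0)//= eqxx big1 ?addr0// => j /negbTE ->.
  rewrite (big_ohead _ m0) -mulr_suml -[X in X / _]/(tensor_form t v i) vr.
  by rewrite divff// mulf_neq0 ?expf_neq0// gt_eqF.
have vp j : v j = 0 -> p j = 0.
  move=> vj; rewrite -pB big1// => i _; rewrite mxE.
  have [vi|vi] := eqVneq (v i) 0.
    rewrite (_ : (j == i0) = false) ?mulr0//.
    by apply/eqP => ji0; rewrite -ji0 vj eqxx in vi0.
  rewrite big1 ?mulr0// => J /eqP Jj; rewrite /k.
  have -> : \prod_(l <- J) v l = 0; last by rewrite mulr0 mul0r.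
  by case: J Jj => -[|l s] ?//= [->]; rewrite big_cons vj mul0r.
have [|omu emu] := kernel_measure_entropy d1 tps r0 v0 vr sp vp; last first.
  by exists (kernel_measure t r v p).
move=> j; rewrite -pB; apply: eq_bigr => i _; rewrite mxE.
rewrite -mulr_sumr; case: eqVneq => // /vp ->; by rewrite !mul0r.
Qed.

(** * The weakly irreducible case *)

(** Stationarity of [w j 0 * u j 0]: this is coordinate [j] of the equation for [w], multiplied by
    [u j 0] and divided by [d.-1] times the spectral radius. *)
Lemma marginal2_eigen_measure (R : realType) (n d : nat) (t : tensor R n d)
    (u w : 'cV[R]_n) :
  (2 < d)%N -> spectral_radius t != 0 ->
  (scaled_jacobian t u)^T *m w = (d.-1%:R * spectral_radius t) *: w ->
  forall j, marginal2 (eigen_measure t u w) j = w j 0 * u j 0.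
Proof.
move=> d2 rN0 Aw j; set r := spectral_radius t in rN0 Aw *.
have m0 : d.-1%:R != 0 :> R.
  by rewrite pnatr_eq0; case: d d2 {t Aw r rN0} => [|[]].
have /matrixP/(_ j 0) := Aw; rewrite !mxE => Awj.
apply: (mulfI (mulf_neq0 m0 rN0)); rewrite mulrA -Awj mulr_suml mulr_sumr.
apply: eq_bigr => i _; rewrite mxE /scaled_jacobian mul_diag_mx !mxE.
rewrite [RHS](_ : _ = d.-1%:R * (u i 0 ^- d.-2 * w i 0 * u j 0) *
  \sum_(J : d.-1.-tuple 'I_n | ohead J == Some j)
    t i J * \prod_(k <- behead J) u k 0); last by ring.
rewrite !mulr_sumr; apply: eq_bigr => J /eqP Jj; rewrite /eigen_measure.
have -> : \prod_(k <- J) u k 0 = u j 0 * \prod_(k <- behead J) u k 0.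
  by case: J Jj => -[|l s] ?//= [->]; rewrite big_cons.
by rewrite -/r; move: (u i 0 ^- d.-2) => c; field.
Qed.

(** Writing [u i 0 ^- d.-2] as [u i 0 / u i 0 ^+ d.-1] exposes the kernel of [u] with initial law
    [w i 0 * u i 0]. *)
Lemma eigen_measureE (R : realType) (n d : nat) (t : tensor R n d)
    (u w : 'cV[R]_n) :
  (1 < d)%N -> spectral_radius t != 0 -> positive_vec u ->
  eigen_measure t u w =
  kernel_measure t (spectral_radius t)
    (fun i => u i 0) (fun i => w i 0 * u i 0).
Proof.
move=> d1 rN0 u0; apply/funext => i; apply/funext => J.
rewrite /eigen_measure /kernel_measure.
have uE : u i 0 ^+ d.-1 = u i 0 * u i 0 ^+ d.-2.
  by rewrite -exprS; case: d d1 {t J rN0} => [|[]].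
have ui : u i 0 != 0 by rewrite gt_eqF.
by rewrite uE; field; rewrite rN0 ui expf_neq0.
Qed.

(** With radius 0, a positive eigenvector forces [t = 0]. Then the digraph has no edges, which is
    impossible for two or more vertices; the extra clause of [weakly_irreducible] handles dimension
    one. *)
Lemma spectral_radius_weakly_irreducible (R : realType) (n d : nat)
    (t : tensor R n d) (u : 'cV[R]_n) :
  (0 < n)%N -> nonneg_tensor t -> weakly_irreducible t -> positive_vec u ->
  tensor_app t u = spectral_radius t *: hadamard_pow u d.-1 ->
  spectral_radius t != 0.
Proof.
move=> n0 t0 [conn n1] u0 ur; apply/eqP => r0.
have tE i J : t i J = 0.
  have : tensor_app t u i 0 = 0 by rewrite ur r0 scale0r mxE.
  have P0 (J' : d.-1.-tuple 'I_n) : 0 < \prod_(j <- J') u j 0.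
    exact: prodr_gt0.
  rewrite mxE => /eqP; rewrite psumr_eq0.
    move/allP => /(_ J); rewrite mem_index_enum mulf_eq0 (gt_eqF (P0 J)) orbF.
    by move/(_ isT)/eqP.
  by move=> J' _; rewrite mulr_ge0// ltW.
case: n => [|[|n]] in t u n0 t0 conn n1 u0 ur r0 tE *; first by [].
  by have [i [J]] := n1 erefl; rewrite tE eqxx.
have /connectP[p] := conn ord0 ord_max.
case: p => [_ /=|j p /= /andP[/existsP[J]]]; first by [].
by rewrite tE ltxx.
Qed.

Theorem theorem19 (R : realType) (n d : nat) (hn : (1 <= n)%N) (hd : (3 <= d)%N)
    (t : tensor R n d) (ht : ps_nonneg t) :
  is_maximum (entropy t @` @occupation_measures R n d)
             (lne (spectral_radius t)%:E) /\
  (weakly_irreducible t ->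
   forall u w : 'cV[R]_n,
     positive_vec u ->
     tensor_app t u = spectral_radius t *: hadamard_pow u d.-1 ->
     positive_vec w ->
     (scaled_jacobian t u)^T *m w = (d.-1%:R * spectral_radius t) *: w ->
     w^T *m u = 1%:M ->
     [/\ occupation_measures (eigen_measure t u w),
         supp (eigen_measure t u w) = supp t
       & lne (spectral_radius t)%:E = entropy t (eigen_measure t u w)]).
Proof.
have d1 : (1 < d)%N := ltnW hd.
have [_ t0] := ht.
have [r0 [v sv vr] ur] := spectral_radius_perron hn d1 t0.
split.
  have ub : ubound (entropy t @` @occupation_measures R n d)
                   (lne (spectral_radius t)%:E).
    (* Comparing exponentials covers radius 0, where the bound is [-oo], and leaves room for the
       slack [e]. *)
    move=> _ [mu omu <-]; rewrite -lee_expeR lneK; last first.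
      by rewrite in_itv/= lee_fin r0 leey.
    apply/lee_addgt0Pr => e e0; have [u u0 ue] := ur e e0.
    have re0 : 0 < spectral_radius t + e by rewrite ltr_wpDl.
    have := entropy_le d1 t0 omu re0 u0 ue; rewrite -lee_expeR /= lnK//.
  split=> //; have [rt0|rtN0] := eqVneq (spectral_radius t) 0.
    (* A maximum [-oo] is attained by any occupation measure,
       e.g. one given by the all-ones tensor. *)
    have ones : @ps_nonneg R n d (fun _ _ => 1).
      by split=> [//|i J]; exact: ler01.
    (* The number of tuples is the eigenvalue of the all-ones tensor at the all-ones vector. *)
    have c0 : 0 < #|{: d.-1.-tuple 'I_n}|%:R :> R.
      by rewrite ltr0n card_tuple card_ord expn_gt0 hn.
    have [|||mu omu _] := @eigenvector_occupation R n d (fun _ _ => 1) _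
        (fun=> 1) d1 ones c0.
    - by move=> i; exact: ler01.
    - by exists (Ordinal hn); exact: oner_neq0.
    - move=> i; rewrite /tensor_form expr1n mulr1.
      under eq_bigr do rewrite big1// mulr1.
      by rewrite sumr_const.
    exists mu => //; have := ub _ (ex_intro2 _ _ mu omu erefl).
    by rewrite rt0 le0_lneNy// leeNy_eq => /eqP.
  have rtp : 0 < spectral_radius t by rewrite lt_neqAle eq_sym rtN0.
  have [v0 _] := sv.
  have [mu omu emu] := eigenvector_occupation d1 ht rtp v0 (simplex_neq0 sv) vr.
  by exists mu => //; rewrite emu lne_EFin.
move=> irr u w u0 ue w0 Aw wu.
have rN0 := spectral_radius_weakly_irreducible hn t0 irr u0 ue.
have rp : 0 < spectral_radius t by rewrite lt_neqAle eq_sym rN0.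
(* The law [w i 0 * u i 0] has total mass 1 by the normalization of [w]. *)
have [] := @kernel_measure_entropy R n d t (spectral_radius t)
  (fun i => u i 0) (fun i => w i 0 * u i 0) d1 ht rp.
- by move=> i; exact: ltW.
- by move=> i; rewrite -tensor_appE ue !mxE.
- split=> [i|]; first by rewrite mulr_ge0// ltW.
  move/matrixP: wu => /(_ 0 0); rewrite !mxE eqxx mulr1n => <-.
  by apply: eq_bigr => i _; rewrite mxE.
- by move=> i ui; have := u0 i; rewrite ui ltxx.
- by move=> j; rewrite -eigen_measureE// (marginal2_eigen_measure hd rN0 Aw).
rewrite -eigen_measureE// => omu emu; split=> //;
  last by rewrite lne_EFin// emu.
apply/seteqP; split=> -[i J]; rewrite /supp/= /eigen_measure.
  have c0 : 0 < (spectral_radius t)^-1 * w i 0 * u i 0 ^- d.-2.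
    by rewrite mulr_gt0 ?invr_gt0 ?exprn_gt0 ?mulr_gt0 ?invr_gt0.
  by rewrite pmulr_lgt0 ?prodr_gt0// pmulr_rgt0.
move=> tp; rewrite mulr_gt0 ?prodr_gt0// mulr_gt0//.
by rewrite mulr_gt0 ?invr_gt0 ?exprn_gt0// mulr_gt0 ?invr_gt0.
Qed.
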